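(* Let $N\ge1$ be an integer and $0<\alpha<\frac2N$. Let $\mathfrak m$ be a nonzero positive finite Borel measure on $\mathbb R^N$. Then, for the equation $\partial_tu=\Delta u+|u|^\alpha u$ on $\mathbb R^N$ with $u(0)=\lambda\mathfrak m$, one has $T_{\max}(\lambda\mathfrak m)<\infty$ for all $\lambda>0$ and $$\limsup_{\lambda\to0}\lambda^{\left(\frac1\alpha-\frac N2\right)^{-1}}T_{\max}(\lambda\mathfrak m)\ \le\ \frac1{\left(\alpha^{1/\alpha}(4\pi)^{-N/2}\|\mathfrak m\|_{\mathcal M}\right)^{\left(\frac1\alpha-\frac N2\right)^{-1}}} .$$
   Context: $\|\mathfrak m\|_{\mathcal M}$ is the total mass (total variation norm) of $\mathfrak m$. $e^{t\Delta}$ is the heat semigroup on $\mathbb R^N$ (convolution with $G_t(x)=(4\pi t)^{-N/2}e^{-|x|^2/4t}$). For a positive Borel measure $u_0$, $T_{\max}(u_0)\in[0,\infty]$ is the maximal existence time of a nonnegative solution of $u(t)=e^{t\Delta}u_0+\int_0^te^{(t-\sigma)\Delta}[|u(\sigma)|^\alpha u(\sigma)]\,d\sigma$, i.e. the supremum of the $T>0$ for which there is a nonnegative, a.e. finite measurable function $u$ on $(0,T)\times\mathbb R^N$ satisfying this equation. *)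

(* Defs.v *)
From HB Require Import structures.
From mathcomp Require Import all_boot all_order all_algebra.
From mathcomp Require Import all_classical all_reals all_analysis.
From mathcomp Require Import measurable_realfun.

Set Implicit Arguments.
Unset Strict Implicit.
Unset Printing Implicit Defensive.

Import Order.TTheory GRing.Theory Num.Theory.
Import numFieldNormedType.Exports.

Local Open Scope classical_set_scope.
Local Open Scope ring_scope.

(* The N-th power of the Borel sigma-algebra of R is the Borel sigma-algebra
   of R^N, because R is second countable. *)
Notation Rvec R N := (N.-tuple (measurableTypeR R)).

Section lebesgue_vec_succ.
Context {R : realType} (n : nat).

Definition vec_cons (p : measurableTypeR R * Rvec R n) : Rvec R n.+1 :=
  [the n.+1.-tuple (measurableTypeR R) of p.1 :: p.2].

Lemma measurable_vec_cons : measurable_fun [set: _] vec_cons.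
Proof. exact: measurable_cons. Qed.

Variable mu : {sigma_finite_measure set (Rvec R n) -> \bar R}.

Definition lebesgue_vec_succ : set (Rvec R n.+1) -> \bar R :=
  pushforward (lebesgue_measure \x mu)%E vec_cons.

Let mcons := measurable_vec_cons.

Let lebesgue_vec_succ0 : lebesgue_vec_succ set0 = 0%E.
Proof. exact: measure0. Qed.

Let lebesgue_vec_succ_ge0 A : (0 <= lebesgue_vec_succ A)%E.
Proof. exact: measure_ge0. Qed.

Let lebesgue_vec_succ_sigma_additive : semi_sigma_additive lebesgue_vec_succ.
Proof. exact: measure_semi_sigma_additive. Qed.

HB.instance Definition _ := isMeasure.Build _ _ _ lebesgue_vec_succ
  lebesgue_vec_succ0 lebesgue_vec_succ_ge0 lebesgue_vec_succ_sigma_additive.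

Let sigma_finite_lebesgue_vec_succ : sigma_finite setT lebesgue_vec_succ.
Proof.
have /sigma_finiteP[F [TF ndF mF]] := sigma_finiteT (@lebesgue_measure R).
have /sigma_finiteP[G [TG ndG mG]] := sigma_finiteT mu.
pose hd (x : Rvec R n.+1) : measurableTypeR R := thead x.
pose tl (x : Rvec R n.+1) : Rvec R n := [tuple of behead x].
have mhd : measurable_fun setT hd by exact: measurable_tnth.
have mtl : measurable_fun setT tl by exact: measurable_behead.
have tlK x t : tl (vec_cons (x, t)) = t by apply/val_inj.
exists (fun k => hd @^-1` F k `&` tl @^-1` G k).
  apply/seteqP; split=> // x _.
  have : setT (hd x) by []. rewrite TF => -[i _ Fi].
  have : setT (tl x) by []. rewrite TG => -[j _ Gj].
  exists (maxn i j) => //; split.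
  - by have /subsetPset := ndF _ _ (leq_maxl i j); exact.
  - by have /subsetPset := ndG _ _ (leq_maxr i j); exact.
move=> k; have [mFk Fk] := mF k; have [mGk Gk] := mG k; split.
  apply: measurableI; rewrite -[X in measurable X]setTI; first exact: mhd.
  exact: mtl.
rewrite /lebesgue_vec_succ /pushforward.
rewrite [X in (_ X < _)%E](_ : _ = F k `*` G k); last first.
  by apply/seteqP; split=> -[x t] /=; rewrite /hd theadE tlK.
by rewrite product_measure1E// lte_mul_pinfty// ge0_fin_numE.
Qed.

HB.instance Definition _ := Measure_isSigmaFinite.Build _ _ _
  lebesgue_vec_succ sigma_finite_lebesgue_vec_succ.

End lebesgue_vec_succ.

Fixpoint lebesgue_vec {R : realType} (N : nat) :
    {sigma_finite_measure set (Rvec R N) -> \bar R} :=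
  match N with
  | 0 => dirac ([tuple] : Rvec R 0)
  | n.+1 => lebesgue_vec_succ (lebesgue_vec n)
  end.

Section heat.
Context {R : realType} (N : nat).
Local Notation RN := (Rvec R N).
Local Notation lebN := (@lebesgue_vec R N).
Implicit Types (x y : RN) (t T alpha : R) (nu : {measure set RN -> \bar R}).

Definition sqnorm x : R := \sum_(i < N) (tnth x i : R) ^+ 2.

Definition vec_sub x y : RN := [tuple (tnth x i : R) - (tnth y i : R) | i < N].

Definition heat_kernel t x : R :=
  (4 * pi * t) `^ (- (N%:R / 2)) * expR (- (sqnorm x / (4 * t))).

Local Open Scope ereal_scope.

Definition heat_measure t nu x : \bar R :=
  \int[nu]_y (heat_kernel t (vec_sub x y))%:E.

Definition heat_fun t (f : RN -> \bar R) x : \bar R :=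
  \int[lebN]_y ((heat_kernel t (vec_sub x y))%:E * f y).

Definition mild_rhs alpha nu (u : measurableTypeR R * RN -> \bar R) t x :
    \bar R :=
  heat_measure t nu x +
  \int[lebesgue_measure]_(s in `]0%R, t[)
    heat_fun (t - s) (fun y => `|u (s, y)| `^ alpha * u (s, y)) x.

(* u takes values in \bar R because a solution is only required to be finite
   almost everywhere; the equation is likewise understood almost everywhere. *)
Definition nonneg_solution alpha nu T
    (u : measurableTypeR R * RN -> \bar R) : Prop :=
  let D := [set p : measurableTypeR R * RN | (0 < (p.1 : R) < T)%R] in
  let mu := (@lebesgue_measure R \x lebN) in
  [/\ measurable_fun D u,
      forall p, D p -> 0 <= u p,
      {ae mu, forall p, D p -> u p \is a fin_num} &
      {ae mu, forall p, D p -> u p = mild_rhs alpha nu u p.1 p.2}].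

(* The supremum is taken in [0, +oo]: it is 0 when there is no solution. *)
Definition Tmax alpha nu : \bar R :=
  ereal_sup ([set 0] `|` [set T%:E | T in
    [set T : R | (0 < T)%R /\ exists u, nonneg_solution alpha nu T u]]).

(* mscale takes a nonnegative scalar; only lambda > 0 is of interest, for which
   the absolute value is harmless. *)
Definition scale_measure (lambda : R) (m : {measure set RN -> \bar R}) :
    {measure set RN -> \bar R} :=
  mscale (`|lambda|%:nng)%R m.

End heat.

(* Main.v *)
Require Import Defs.
From mathcomp Require Import all_boot all_order all_algebra.
From mathcomp Require Import all_classical all_reals all_analysis.
From mathcomp Require Import ring lra measurable_realfun.
Import Order.TTheory GRing.Theory Num.Theory.
Import numFieldNormedType.Exports.
Local Open Scope classical_set_scope.
Local Open Scope ring_scope.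

Set Implicit Arguments.
Unset Strict Implicit.
Unset Printing Implicit Defensive.

(* For a solution [u] on (0, T) with initial datum [nu], fix (t, x) where the
   equation holds and put, for 0 < s < t,
     Psi(s) = (e^{t Delta} nu)(x)
              + \int_0^s (e^{(t - r) Delta} u(r)^{1 + alpha})(x) dr.
   Applying e^{(t - s) Delta} to the equation at time [s] shows that
   Psi(s) = (e^{(t - s) Delta} u(s))(x), so Jensen's inequality for the
   probability density of the heat kernel gives Psi' >= Psi^{1 + alpha}. As
   Psi(t) = u(t, x) is finite, t cannot exceed the blow-up time of this
   differential inequality, i.e. alpha t ((e^{t Delta} nu)(x))^alpha <= 1.
   For nu = lambda m, (4 pi t)^{N/2} (e^{t Delta} m)(x) tends to the mass of [m]
   as t -> oo, uniformly for [x] in a ball, which turns this necessary condition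
   into the upper bound on the existence time. *)

(** * One-dimensional Gaussian densities and their convolution *)

Section gauss.
Context {R : realType}.
Implicit Types (a b t x y z : R).

Definition gauss_density t x : R :=
  (4 * pi * t) `^ (- 2^-1) * expR (- (x ^+ 2 / (4 * t))).

Lemma gauss_density_ge0 t x : 0 <= gauss_density t x.
Proof. by rewrite mulr_ge0 ?powR_ge0 ?expR_ge0. Qed.

Lemma measurable_gauss_density t : measurable_fun setT (gauss_density t).
Proof.
apply: measurable_funM => //; apply: measurableT_comp => //.
apply: measurableT_comp => //; by apply: measurable_funM.
Qed.

(** The heat kernel at time [t] is the normal law of variance [2 * t]; its total mass is therefore
    that of a normal density. *)
Lemma gauss_densityE t x y : 0 < t ->
  gauss_density t (x - y) = normal_pdf x (Num.sqrt (2 * t)) y.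
Proof.
move=> t0; have t20 : 0 < 2 * t by rewrite mulr_gt0.
rewrite normal_pdfE ?gt_eqF ?sqrtr_gt0//.
rewrite /gauss_density /normal_peak /normal_fun sqr_sqrtr ?ltW//.
rewrite powRN powR12_sqrt; last by rewrite !mulr_ge0 ?pi_ge0// ltW.
congr (_^-1 * expR _); first by congr Num.sqrt; rewrite -mulr_natr; ring.
rewrite -mulr_natr; field; lra.
Qed.

(** Completing the square in [y]: the first factor on the right no longer depends on [y], and the
    second is a Gaussian density in [y], so integrating in [y] yields the semigroup law. *)
Lemma gauss_density_mul a b x y z : 0 < a -> 0 < b ->
  gauss_density a (x - y) * gauss_density b (y - z) =
  gauss_density (a + b) (x - z) *
  gauss_density (a * b / (a + b)) ((b * x + a * z) / (a + b) - y).
Proof.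
move=> a0 b0; have ab0 : 0 < a + b by rewrite addr_gt0.
have p4 : 0 <= 4 * pi :> R by rewrite mulr_ge0// pi_ge0.
rewrite /gauss_density [LHS]mulrACA [RHS]mulrACA -!expRD.
have c0 : 0 <= a * b / (a + b) by rewrite divr_ge0 ?mulr_ge0 ?ltW.
have p4M t : 0 <= t -> 0 <= 4 * pi * t by exact: mulr_ge0.
rewrite -(powRM _ (p4M _ (ltW a0)) (p4M _ (ltW b0))).
rewrite -(powRM _ (p4M _ (ltW ab0)) (p4M _ c0)).
by congr (_ `^ _ * expR _); field; rewrite ?gt_eqF.
Qed.

Local Open Scope ereal_scope.

Lemma integral_gauss_density t x : (0 < t)%R ->
  \int[lebesgue_measure]_y (gauss_density t (x - y))%:E = 1.
Proof.
by move=> t0; under eq_integral do rewrite gauss_densityE//; exact: integral_normal_pdf.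
Qed.

Lemma gauss_density_semigroup a b x z : (0 < a)%R -> (0 < b)%R ->
  \int[lebesgue_measure]_y (gauss_density a (x - y) * gauss_density b (y - z))%:E
  = (gauss_density (a + b) (x - z))%:E.
Proof.
move=> a0 b0; have ab0 : (0 < a + b)%R by rewrite addr_gt0.
under eq_integral do rewrite gauss_density_mul// EFinM.
rewrite ge0_integralZl_EFin//=.
- by rewrite integral_gauss_density ?mule1// divr_gt0// mulr_gt0.
- by move=> y _; rewrite lee_fin gauss_density_ge0.
- apply/measurable_EFinP/(measurableT_comp (measurable_gauss_density _)).
  exact: measurable_funB.
- exact: gauss_density_ge0.
Qed.

End gauss.

(** * The heat kernel in dimension [N]: total mass and semigroup law *)

Section heat_kernel.
Context {R : realType}.

Lemma heat_kernel_ge0 (N : nat) (t : R) (x : Rvec R N) : 0 <= heat_kernel t x.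
Proof. by rewrite mulr_ge0 ?powR_ge0 ?expR_ge0. Qed.

(** Splitting off the first coordinate reduces integrals of the kernel to dimension one by induction
    on [N]. *)
Lemma heat_kernel_cons (N : nat) (t : R) (x y : Rvec R N.+1) : 0 < t ->
  heat_kernel t (vec_sub x y) = gauss_density t (thead x - thead y) *
    heat_kernel t (vec_sub [tuple of behead x] [tuple of behead y]).
Proof.
move=> t0; rewrite /heat_kernel /gauss_density mulrACA -expRD -powRD; last first.
  by apply/implyP => _; rewrite gt_eqF// !mulr_gt0// pi_gt0.
congr (_ `^ _ * expR _).
  by rewrite -natr1 -opprD; congr (- _); field.
rewrite -opprD -mulrDl; congr (- (_ / _)).
rewrite /sqnorm big_ord_recl !tnth_mktuple.
apply: (f_equal2 +%R); first by [].
apply: eq_bigr => i _; rewrite !tnth_mktuple !tnth_behead.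
by rewrite (_ : inord i.+1 = lift ord0 i)//; apply/val_inj; rewrite /= inordK// ltnS.
Qed.

Local Open Scope ereal_scope.

Lemma measurable_sqnorm (N : nat) : measurable_fun setT (@sqnorm R N).
Proof.
apply: measurable_sum => i; apply: measurable_funX; exact: measurable_tnth.
Qed.

Lemma measurable_fun_sqnorm_sub (N : nat) d (T : measurableType d)
    (f g : T -> Rvec R N) :
  measurable_fun setT f -> measurable_fun setT g ->
  measurable_fun setT (fun z => sqnorm (vec_sub (f z) (g z))).
Proof.
move=> mf mg; rewrite /sqnorm; apply: measurable_sum => i.
apply: measurable_funX; under eq_fun do rewrite tnth_mktuple.
apply: measurable_funB.
  exact: (measurableT_comp (measurable_tnth i) mf).
exact: (measurableT_comp (measurable_tnth i) mg).
Qed.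

Lemma measurable_fun_heat_kernel (N : nat) d (T : measurableType d)
    (t : R) (f g : T -> Rvec R N) :
  measurable_fun setT f -> measurable_fun setT g ->
  measurable_fun setT (fun z => heat_kernel t (vec_sub (f z) (g z))).
Proof.
move=> mf mg; apply: measurable_funM => //; apply: measurableT_comp => //.
apply: measurableT_comp => //; apply: measurable_funM => //.
exact: measurable_fun_sqnorm_sub.
Qed.

(** [lebesgue_vec N.+1] is the image of a product measure under [vec_cons], so a change of variables
    followed by Tonelli separates the two factors. *)
Lemma integral_lebesgue_vec_succ (N : nat) (f : R -> R) (g : Rvec R N -> R) :
  measurable_fun setT f -> measurable_fun setT g ->
  (forall x, 0 <= f x)%R -> (forall x, 0 <= g x)%R ->
  \int[lebesgue_vec N.+1]_y (f (thead y) * g [tuple of behead y])%:E =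
  (\int[lebesgue_measure]_x (f x)%:E) * \int[lebesgue_vec N]_y (g y)%:E.
Proof.
move=> mf mg f0 g0.
have mfg : measurable_fun setT
    (fun p : measurableTypeR R * Rvec R N => (f p.1 * g p.2)%:E).
  apply/measurable_EFinP/measurable_funM.
    by apply: measurableT_comp => //; exact: measurable_fst.
  by apply: measurableT_comp => //; exact: measurable_snd.
transitivity (\int[(lebesgue_measure \x lebesgue_vec N)%E]_p (f p.1 * g p.2)%:E).
  rewrite /= /lebesgue_vec_succ ge0_integral_pushforward//=.
  - apply: eq_integral => p _ /=; rewrite theadE; congr (f _ * g _)%:E.
    exact/val_inj.
  - exact: measurable_vec_cons.
  - apply/measurable_EFinP/measurable_funM.
      by apply: measurableT_comp => //; exact: measurable_tnth.
    by apply: measurableT_comp => //; exact: measurable_behead.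
  - by move=> y _; rewrite lee_fin mulr_ge0.
rewrite fubini_tonelli1//; last by move=> p; rewrite lee_fin mulr_ge0.
rewrite /fubini_F /=.
transitivity (\int[lebesgue_measure]_x ((f x)%:E * \int[lebesgue_vec N]_y (g y)%:E)).
  apply: eq_integral => x _; under eq_integral do rewrite EFinM.
  rewrite ge0_integralZl_EFin//; last exact/measurable_EFinP.
  by move=> y _; rewrite lee_fin.
rewrite ge0_integralZr//; first exact/measurable_EFinP.
  by move=> x _; rewrite lee_fin.
by apply: integral_ge0 => y _; rewrite lee_fin.
Qed.

Lemma integral_heat_kernel (N : nat) (t : R) (x : Rvec R N) : (0 < t)%R ->
  \int[lebesgue_vec N]_y (heat_kernel t (vec_sub x y))%:E = 1.
Proof.
move=> t0; elim: N x => [|N IH] x.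
  rewrite /= integral_dirac//=; last first.
    exact/measurable_EFinP/measurable_fun_heat_kernel.
  rewrite diracT mul1e /heat_kernel /sqnorm big_ord0.
  by rewrite mul0r oppr0 powRr0 mul0r oppr0 expR0 mulr1.
under eq_integral do rewrite heat_kernel_cons//.
rewrite (@integral_lebesgue_vec_succ _ (fun y => gauss_density t (thead x - y))
  (fun y => heat_kernel t (vec_sub [tuple of behead x] y))).
- by rewrite integral_gauss_density// IH mule1.
- apply: (measurableT_comp (measurable_gauss_density _)).
  exact: measurable_funB.
- exact: measurable_fun_heat_kernel.
- by move=> y; exact: gauss_density_ge0.
- by move=> y; exact: heat_kernel_ge0.
Qed.

Lemma heat_kernel_semigroup (N : nat) (a b : R) (x z : Rvec R N) :
  (0 < a)%R -> (0 < b)%R ->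
  \int[lebesgue_vec N]_y
    (heat_kernel a (vec_sub x y) * heat_kernel b (vec_sub y z))%:E =
  (heat_kernel (a + b) (vec_sub x z))%:E.
Proof.
move=> a0 b0; have ab0 : (0 < a + b)%R by rewrite addr_gt0.
elim: N x z => [|N IH] x z.
  rewrite /= integral_dirac//=; last first.
    by apply/measurable_EFinP/measurable_funM; exact: measurable_fun_heat_kernel.
  rewrite diracT mul1e /heat_kernel /sqnorm !big_ord0.
  by rewrite !mul0r !oppr0 !powRr0 expR0 !mulr1.
under eq_integral do rewrite !heat_kernel_cons// mulrACA.
rewrite (@integral_lebesgue_vec_succ _
  (fun y => gauss_density a (thead x - y) * gauss_density b (y - thead z))
  (fun y => heat_kernel a (vec_sub [tuple of behead x] y) *
            heat_kernel b (vec_sub y [tuple of behead z])))%R.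
- by rewrite gauss_density_semigroup// IH heat_kernel_cons// EFinM.
- apply: measurable_funM; apply: (measurableT_comp (measurable_gauss_density _));
    exact: measurable_funB.
- by apply: measurable_funM; exact: measurable_fun_heat_kernel.
- by move=> y; rewrite mulr_ge0// gauss_density_ge0.
- by move=> y; rewrite mulr_ge0// heat_kernel_ge0.
Qed.

End heat_kernel.

(** * The heat kernel extended by zero to nonpositive times *)

Section kern.
Context {R : realType} (N : nat).
Local Notation RN := (Rvec R N).
Local Notation lebN := (@lebesgue_vec R N).
Local Open Scope ereal_scope.

(* Vanishing for [t <= 0] encodes the time constraints of Duhamel's formula, so
   that every integral can be taken over the whole space. *)
Definition kern (t : R) (x y : RN) : \bar R :=
  if (0 < t)%R then (heat_kernel t (vec_sub x y))%:E else 0.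

Lemma kern_ge0 t x y : 0 <= kern t x y.
Proof. by rewrite /kern; case: ifP => // _; rewrite lee_fin heat_kernel_ge0. Qed.

Lemma measurable_fun_kern d (T : measurableType d) (t : T -> R) (f g : T -> RN) :
  measurable_fun setT t -> measurable_fun setT f -> measurable_fun setT g ->
  measurable_fun setT (fun z => kern (t z) (f z) (g z)).
Proof.
move=> mt mf mg.
(* The inverse of [4 * t z] is written as a power with exponent [-1], so that measurability in time
   follows from that of powers; the two agree where [t z] is positive. *)
pose h z : R := ((4 * pi * t z) `^ (- (N%:R / 2)) *
   expR (- (sqnorm (vec_sub (f z) (g z)) * (4 * t z) `^ (-1))))%R.
rewrite [X in measurable_fun _ X](_ : _ =
    (fun z => if (0 < t z)%R then (h z)%:E else 0)); last first.
  apply/funext => z; rewrite /kern /h /heat_kernel; case: ifPn => // tz.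
  by rewrite powR_inv1// mulr_ge0// ltW.
apply: measurable_fun_ifT => //; first exact: measurable_fun_ltr.
apply/measurable_EFinP/measurable_funM.
  apply: (measurableT_comp (measurable_powR _)).
  exact: measurable_funM.
apply: measurableT_comp => //; apply: measurableT_comp => //.
apply: measurable_funM; first exact: measurable_fun_sqnorm_sub.
apply: (measurableT_comp (measurable_powR _)).
exact: measurable_funM.
Qed.

Lemma integral_kern t x : (0 < t)%R -> \int[lebN]_y kern t x y = 1.
Proof. by move=> t0; rewrite /kern t0 integral_heat_kernel. Qed.

(** For [b <= 0] the left side vanishes although [kern (a + b)] need not. This case distinction
    later truncates the Duhamel integral at the intermediate time. *)
Lemma kern_semigroup a b x z : (0 < a)%R ->
  \int[lebN]_y (kern a x y * kern b y z) =
  if (0 < b)%R then kern (a + b) x z else 0.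
Proof.
move=> a0; rewrite /kern a0; case: ifPn => b0.
  by rewrite addr_gt0// -heat_kernel_semigroup.
by rewrite integral0_eq// => y _; rewrite mule0.
Qed.

End kern.

(** * Jensen's inequality for the power [1 + alpha] *)

Section jensen.
Context {R : realType}.
Implicit Types alpha c v : R.

(* Young's inequality with exponents [1 + alpha] and [(1 + alpha) / alpha]. *)
Lemma powR_tangent_le alpha c v : 0 < alpha -> 0 <= c -> 0 <= v ->
  (1 + alpha) * c `^ alpha * v <= v `^ alpha * v + alpha * (c `^ alpha * c).
Proof.
move=> a0 c0 v0; have p0 : 0 < 1 + alpha by rewrite addr_gt0.
have mulpow x : 0 <= x -> x `^ alpha * x = x `^ (1 + alpha).
  move=> x0; rewrite powRD; last by apply/implyP; rewrite gt_eqF.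
  by rewrite powRr1// mulrC.
rewrite !mulpow//.
have := @conjugate_powR R v (c `^ alpha) (1 + alpha) ((1 + alpha) / alpha) v0
  (powR_ge0 _ _) p0 (divr_gt0 p0 a0).
rewrite -powRrM mulrCA divff ?gt_eqF// mulr1.
have -> : (1 + alpha)^-1 + ((1 + alpha) / alpha)^-1 = 1.
  by field; rewrite !gt_eqF.
move=> /(_ erefl) young.
have := ler_wpM2l (ltW p0) young.
rewrite (_ : (1 + alpha) * (_ / _ + _) = v `^ (1 + alpha) + alpha * c `^ (1 + alpha)).
  by rewrite mulrAC mulrA.
by field; rewrite !gt_eqF.
Qed.

Local Open Scope ereal_scope.

(** At [v = +oo] the right side is infinite; otherwise this is the real inequality. *)
Lemma poweR_tangent_le alpha c (v : \bar R) : (0 < alpha)%R -> (0 <= c)%R ->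
  0 <= v -> ((1 + alpha) * c `^ alpha)%:E * v <=
    `|v| `^ alpha * v + (alpha * (c `^ alpha * c))%:E.
Proof.
move=> a0 c0; case: v => [v v0| _|//].
  by rewrite abse_EFin ger0_norm// poweR_EFin -!EFinM -EFinD lee_fin powR_tangent_le.
by rewrite gee0_abs// poweRyr ?gt_eqF// mulyy addye// leey.
Qed.

(** The tangent inequality at [c] is integrated against the probability density [k]. Moving only the
    finite constant [alpha * c^(1 + alpha)] across the inequality keeps the argument valid when the
    integrals are infinite. *)
Lemma jensen_powR d (T : measurableType d) (mu : {measure set T -> \bar R})
    (k f : T -> \bar R) alpha c :
  measurable_fun setT k -> measurable_fun setT f ->
  (forall x, 0 <= k x) -> (forall x, 0 <= f x) ->
  \int[mu]_x k x = 1 -> (0 < alpha)%R -> (0 <= c)%R ->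
  c%:E <= \int[mu]_x (k x * f x) ->
  (c `^ alpha * c)%:E <= \int[mu]_x (k x * (`|f x| `^ alpha * f x)).
Proof.
move=> mk mf k0 f0 k1 a0 c0 cf.
have mfa : measurable_fun setT (fun x => `|f x| `^ alpha * f x).
  apply: emeasurable_funM => //; apply: (measurableT_comp (measurable_poweR _)).
  exact: measurableT_comp.
have fa0 x : 0 <= `|f x| `^ alpha * f x by rewrite mule_ge0// poweR_ge0.
have q0 : (0 <= (1 + alpha) * c `^ alpha)%R.
  by rewrite mulr_ge0 ?powR_ge0// addr_ge0// ltW.
have r0 : (0 <= alpha * (c `^ alpha * c))%R.
  by rewrite !mulr_ge0 ?powR_ge0// ltW.
have : \int[mu]_x (((1 + alpha) * c `^ alpha)%:E * (k x * f x)) <=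
    \int[mu]_x (k x * (`|f x| `^ alpha * f x) +
                (alpha * (c `^ alpha * c))%:E * k x).
  apply: ge0_le_integral => //.
  - by move=> x _; rewrite mule_ge0// mule_ge0.
  - by apply: emeasurable_funM => //; exact: emeasurable_funM.
  - apply: emeasurable_funD; first exact: emeasurable_funM.
    exact: emeasurable_funM.
  - move=> x _; rewrite muleCA [X in _ + X]muleC -ge0_muleDr ?lee_fin//.
    by rewrite lee_pmul// ?poweR_tangent_le// mule_ge0.
rewrite ge0_integralZl_EFin//; last 2 first.
- by move=> x _; rewrite mule_ge0.
- exact: emeasurable_funM.
rewrite ge0_integralD//; last 4 first.
- by move=> x _; rewrite mule_ge0.
- exact: emeasurable_funM.
- by move=> x _; rewrite mule_ge0.
- exact: emeasurable_funM.
rewrite ge0_integralZl_EFin// k1 mule1.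
move=> h; have := le_trans (lee_wpmul2l _ cf) h; rewrite lee_fin => /(_ q0).
rewrite -EFinM -leeBlDr// -EFinB; apply: le_trans.
by rewrite lee_fin lerBrDr mulrDl mul1r mulrDl -mulrA.
Qed.
End jensen.

(** * Blow-up time of the differential inequality, in discrete form *)

Section blow_up.
Context {R : realType}.
Implicit Types alpha c s t h q x : R.

(** The right side equals [q * (q^alpha - 1)]. It remains to combine [q^alpha - 1 >= alpha * ln q]
    with [q * ln q >= q - 1]. *)
Lemma powR_sub1_ge alpha q : 0 < alpha -> 1 < q ->
  alpha * (q - 1) <= q `^ (1 + alpha) * (1 - q `^ (- alpha)).
Proof.
move=> a0 q1; have q0 : 0 < q by rewrite (lt_trans _ q1).
have -> : q `^ (1 + alpha) * (1 - q `^ (- alpha)) = q * (q `^ alpha - 1).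
  rewrite powRN powRD; last by apply/implyP => _; rewrite gt_eqF.
  rewrite powRr1 ?ltW//; field; rewrite gt_eqF ?powR_gt0//.
have lnq : q - 1 <= q * ln q.
  have qV : -1 < q^-1 - 1 by rewrite ltrBrDr addNr invr_gt0.
  have := le_ln1Dx qV; rewrite addrC subrK lnV//.
  move=> /(ler_wpM2l (ltW q0)); rewrite mulrBr divff ?gt_eqF// mulr1.
  by rewrite mulrN; lra.
have : alpha * ln q <= q `^ alpha - 1.
  rewrite lerBrDr addrC /powR gt_eqF//; exact: expR_ge1Dx.
move=> /(ler_wpM2l (ltW q0)); apply: le_trans.
by rewrite mulrCA ler_wpM2l// ltW.
Qed.

(* With [q > 1], the level [q ^ k * c] is reached before the time
   [(q - 1) * c `^ (- alpha) * (1 + q `^ (- alpha) + ... )], so the blow-up time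
   is at most the sum of this geometric series; letting [q] tend to [1] yields
   [c `^ (- alpha) / alpha]. *)
Lemma blow_up_time (F : R -> \bar R) alpha c t : 0 < alpha -> 0 < c -> 0 < t ->
  (F t < +oo)%E -> (c%:E <= F 0%R)%E ->
  (forall s h b, 0 <= s -> 0 < h -> s + h <= t -> 0 < b ->
     (b%:E <= F s)%E -> ((b + h * (b `^ alpha * b))%:E <= F (s + h)%R)%E) ->
  alpha * t * c `^ alpha <= 1.
Proof.
move=> a0 c0 t0 Ft F0 step.
suff geom q : 1 < q -> t * (1 - q `^ (- alpha)) * c `^ alpha <= q - 1.
  have H q : 1 < q -> alpha * t * c `^ alpha <= q `^ (1 + alpha).
    move=> q1; rewrite -(ler_pM2r (_ : 0 < q - 1)) ?subr_gt0//.
    have tc0 : 0 <= t * c `^ alpha by rewrite mulr_ge0 ?powR_ge0 ?ltW.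
    have := ler_wpM2l tc0 (powR_sub1_ge a0 q1).
    have := ler_wpM2l (powR_ge0 q (1 + alpha)) (geom q q1).
    by lra.
  rewrite leNgt; apply/negP => X1; set X := _ * _ in X1 H.
  have p0 : 0 < 1 + alpha by rewrite addr_gt0.
  have X0 : 0 < X by rewrite (lt_trans _ X1).
  (* For this [q] the bound [q^(1 + alpha)] is the square root of [X], which is less than [X] when
     [X > 1]. *)
  pose q := X `^ (2^-1 / (1 + alpha)).
  have : X <= q `^ (1 + alpha).
    apply: H; have e0 : 0 < 2^-1 / (1 + alpha) by rewrite divr_gt0.
    by have := gt0_ltr_powR e0 ler01 (ltW X0) X1; rewrite powR1.
  rewrite -powRrM -mulrA mulVf ?gt_eqF// mulr1 powR12_sqrt ?(ltW X0)//.
  rewrite leNgt => /negP; apply.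
  rewrite -[ltRHS]gtr0_norm// -sqrtr_sqr ltr_sqrt ?exprn_gt0//.
  by rewrite expr2 ltr_pMr.
move=> q1; rewrite leNgt; apply/negP => ht.
have q0 : 0 < q by rewrite (lt_trans _ q1).
set r := q `^ (- alpha) in ht *.
have r0 : 0 < r by rewrite powR_gt0.
have r1 : r < 1.
  rewrite /r powRN invf_lt1 ?powR_gt0//.
  by have := gt0_ltr_powR a0 ler01 (ltW q0) q1; rewrite powR1.
have ca0 : 0 < c `^ alpha by rewrite powR_gt0.
have r10 : 0 < 1 - r by rewrite subr_gt0.
(* [S] is the sum of the geometric series of waiting times and [s k] its partial sums; the negated
   claim [ht] says that [S < t]. *)
pose S := (q - 1) / c `^ alpha / (1 - r).
have St : S < t by rewrite /S !ltr_pdivrMr.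
have S0 : 0 < S by rewrite !divr_gt0// subr_gt0.
pose s k := S * (1 - r ^+ k).
have s_ge0 k : 0 <= s k.
  by rewrite mulr_ge0 ?(ltW S0)// subr_ge0 exprn_ile1// ltW.
have s_lt k : s k < t.
  by rewrite (le_lt_trans _ St)// ger_pMr// gerBl exprn_ge0// ltW.
(* The waiting time [(q - 1) / c^alpha * r^k] is what the growth rate at level [q^k * c] needs to
   multiply that level by [q]. *)
have level k : ((q ^+ k * c)%:E <= F (s k))%E.
  elim: k => [|k IH]; first by rewrite /s !expr0 subrr mulr0 mul1r.
  have hE : s k.+1 = s k + (q - 1) / c `^ alpha * r ^+ k.
    by rewrite /s /S exprS; field; rewrite !gt_eqF.
  have -> : q ^+ k.+1 * c = q ^+ k * c + (q - 1) / c `^ alpha * r ^+ k *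
      ((q ^+ k * c) `^ alpha * (q ^+ k * c)).
    have -> : r ^+ k = ((q ^+ k) `^ alpha)^-1.
      by rewrite /r -!powR_mulrn ?ltW// ?powR_gt0// -!powRrM -powRN mulrC mulrN.
    rewrite powRM ?exprn_ge0 ?(ltW q0) ?(ltW c0)// exprS.
    by field; rewrite !gt_eqF// ?powR_gt0// exprn_gt0.
  rewrite hE; apply: step => //.
  - by rewrite !mulr_gt0 ?invr_gt0 ?exprn_gt0// subr_gt0.
  - by rewrite -hE ltW.
  - by rewrite mulr_gt0// exprn_gt0.
(* One more step, from [s k] to [t], carries every level over to time [t]. *)
have Flevel k : ((q ^+ k * c)%:E <= F t)%E.
  have := step (s k) (t - s k) (q ^+ k * c) (s_ge0 k).
  rewrite subr_gt0 s_lt addrC subrK lexx => /(_ isT isT).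
  rewrite mulr_gt0 ?exprn_gt0// => /(_ isT (level k)); apply: le_trans.
  rewrite lee_fin lerDl !mulr_ge0 ?powR_ge0 ?exprn_ge0 ?(ltW c0) ?(ltW q0)//.
  by rewrite subr_ge0 ltW.
move: Ft Flevel; case: (F t) => [M _ H|//|_ /(_ 0)//].
(* Bernoulli's inequality makes the levels unbounded, contradicting the finite value [M] of
   [F t]. *)
have bernoulli k : 1 + k%:R * (q - 1) <= q ^+ k.
  elim: k => [|k IH]; first by rewrite mul0r addr0 expr0.
  have := ler_wpM2l (ltW q0) IH; rewrite -exprS -natr1; apply: le_trans.
  by have := mulr_ge0 (ler0n R k) (sqr_ge0 (q - 1)); lra.
have M0 : 0 <= M.
  have := H 0%N; rewrite lee_fin expr0 mul1r; apply: le_trans; exact: ltW.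
have d0 : 0 < c * (q - 1) by rewrite mulr_gt0// subr_gt0.
have := archi_boundP (divr_ge0 M0 (ltW d0)); rewrite ltr_pdivrMr//.
set k := Num.bound _ => Mk; have := H k; rewrite lee_fin leNgt => /negP; apply.
rewrite (lt_le_trans Mk)// mulrCA mulrC ler_pM2r//.
by rewrite (le_trans _ (bernoulli k))// lerDr.
Qed.

End blow_up.

(** * Consequences of Tonelli's theorem *)

Section tonelli.
Local Open Scope ereal_scope.
Context d1 d2 (T1 : measurableType d1) (T2 : measurableType d2) (R : realType).

(** The product measure of a null set is the integral of the measures of its sections, so almost
    every section is null. *)
Lemma ae_xsection (m1 : {measure set T1 -> \bar R})
    (m2 : {sigma_finite_measure set T2 -> \bar R}) (P : T1 * T2 -> Prop) :
  {ae (m1 \x m2)%E, forall p, P p} ->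
  {ae m1, forall x, {ae m2, forall y, P (x, y)}}.
Proof.
move=> [A [mA A0 PA]].
have mxA : measurable_fun setT (m2 \o xsection A) by exact: measurable_fun_xsection.
have : ae_eq m1 setT (m2 \o xsection A) (cst 0).
  apply/ae_eq_integral_abs => //.
  rewrite -[RHS]A0; apply: eq_integral => x _; rewrite gee0_abs//.
apply: filterS => x /(_ I) /= xA0.
exists (xsection A x); split => //; first exact: measurable_xsection.
by move=> y nP; rewrite /xsection /= inE; exact: PA.
Qed.

Lemma integral_mul_swap (m1 : {sigma_finite_measure set T1 -> \bar R})
    (m2 : {sigma_finite_measure set T2 -> \bar R})
    (k : T1 -> \bar R) (f : T1 * T2 -> \bar R) :
  measurable_fun setT k -> measurable_fun setT f ->
  (forall y, 0 <= k y) -> (forall p, 0 <= f p) ->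
  \int[m1]_y (k y * \int[m2]_z f (y, z)) =
  \int[m2]_z \int[m1]_y (k y * f (y, z)).
Proof.
move=> mk mf k0 f0.
rewrite -(@fubini_tonelli _ _ _ _ _ m1 m2 (fun p => k p.1 * f p)); last 2 first.
- by apply: emeasurable_funM => //; exact: measurableT_comp.
- by move=> p; rewrite mule_ge0.
apply: eq_integral => y _ /=; rewrite ge0_integralZl//.
exact: measurableT_comp.
Qed.

End tonelli.

(** * The differential inequality along a solution *)

Section mild_solution.
Context {R : realType} (N : nat).
Local Notation RN := (Rvec R N).
Local Notation lebN := (@lebesgue_vec R N).
Local Notation leb := (@lebesgue_measure R).
Local Open Scope ereal_scope.
Variables (alpha T : R) (nu : {sigma_finite_measure set RN -> \bar R}).
Variable u : measurableTypeR R * RN -> \bar R.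
Hypothesis a0 : (0 < alpha)%R.
Hypothesis hu : nonneg_solution alpha nu T u.

Let D := [set p : measurableTypeR R * RN | (0 < (p.1 : R) < T)%R].

Let mD : measurable D.
Proof.
rewrite (_ : D = fst @^-1` [set` `]0%R, T[]); last first.
  by apply/seteqP; split => p /=; rewrite in_itv.
by rewrite -[X in measurable X]setTI; exact: measurable_fst.
Qed.

(** Extension by zero outside the time interval (0, [T]) gives a function measurable on the whole
    space and removes the lower limit of the Duhamel integral. *)
Let source : measurableTypeR R * RN -> \bar R :=
  (fun p => `|u p| `^ alpha * u p) \_ D.

Let source_ge0 p : 0 <= source p.
Proof.
rewrite /source patchE; case: ifPn => // /set_mem Dp.
by rewrite mule_ge0 ?poweR_ge0//; case: hu => _ + _ _; exact.
Qed.

Let measurable_source : measurable_fun setT source.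
Proof.
apply: (measurable_restrictT _ mD).1; case: hu => mu _ _ _.
apply: emeasurable_funM => //; apply: (measurableT_comp (measurable_poweR _)).
exact: measurableT_comp.
Qed.

Let duhamel t x s := \int[lebN]_z (kern (t - s) x z * source (s, z)).

Let duhamel_ge0 t x s : 0 <= duhamel t x s.
Proof. by apply: integral_ge0 => z _; rewrite mule_ge0// kern_ge0. Qed.

Let measurable_kern_source t : measurable_fun setT
  (fun q : (RN * measurableTypeR R) * RN =>
     kern (t - q.1.2) q.1.1 q.2 * source (q.1.2, q.2)).
Proof.
have m1 : measurable_fun setT (fun q : (RN * measurableTypeR R) * RN => q.1.1).
  exact: measurableT_comp.
have m2 : measurable_fun setT (fun q : (RN * measurableTypeR R) * RN => q.1.2).
  exact: measurableT_comp.
apply: emeasurable_funM.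
  by apply: measurable_fun_kern => //; exact: measurable_funB.
by apply: measurableT_comp => //; exact: measurable_fun_pair.
Qed.

Let measurable_duhamel2 t : measurable_fun setT
  (fun q : RN * measurableTypeR R => duhamel t q.1 q.2).
Proof.
have f0 (q : (RN * measurableTypeR R) * RN) :
    0 <= kern (t - q.1.2) q.1.1 q.2 * source (q.1.2, q.2).
  by rewrite mule_ge0// kern_ge0.
have := measurable_fun_fubini_tonelli_F (m2 := lebN) _ (measurable_kern_source t) f0.
exact.
Qed.

Let measurable_duhamel t x : measurable_fun setT (duhamel t x).
Proof. exact: (measurable_fun_pair2 x (measurable_duhamel2 t)). Qed.

(** The kernel keeps the final time [t] while the integral stops at [s]. Starting at [-oo] is
    harmless because [source] vanishes at nonpositive times. *)
Let Psi t x s := heat_measure t nu x + \int[leb]_(r in `]-oo, s[) duhamel t x r.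

Let heat_measureE t x : (0 < t)%R ->
  heat_measure t nu x = \int[nu]_z kern t x z.
Proof. by move=> t0; apply: eq_integral => z _; rewrite /kern t0. Qed.

Let heat_measure_ge0 t x : 0 <= heat_measure t nu x.
Proof. by apply: integral_ge0 => z _; rewrite lee_fin heat_kernel_ge0. Qed.

Let Psi_ge0 t x s : 0 <= Psi t x s.
Proof. by rewrite /Psi; apply: adde_ge0 => //; exact: integral_ge0. Qed.

Let duhamel_cut t x : \int[leb]_(r in `]-oo, t[) duhamel t x r =
  \int[leb]_r duhamel t x r.
Proof.
rewrite integral_mkcond; apply: eq_integral => r _; rewrite patchE.
case: ifPn => //; rewrite notin_setE/= in_itv/= => /negP; rewrite -leNgt => tr.
rewrite /duhamel integral0_eq// => z _.
by rewrite /kern subr_gt0 ltNge tr mul0e.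
Qed.

(** For [r >= t] the kernel vanishes and for [r <= 0] the source does, so both integrals have the
    same effective domain. *)
Let mild_rhsE t x : (0 < t < T)%R -> mild_rhs alpha nu u t x = Psi t x t.
Proof.
move=> /andP[t0 tT]; rewrite /mild_rhs /Psi; congr (_ + _).
rewrite duhamel_cut integral_mkcond; apply: eq_integral => r _; rewrite patchE.
case: ifPn.
  rewrite inE/= in_itv/= => /andP[r0 rt]; apply: eq_integral => z _.
  rewrite /kern subr_gt0 rt /source patchE mem_set//.
  by rewrite /D /= r0 (lt_trans rt).
rewrite notin_setE/= in_itv/= => /negP; rewrite negb_and -!leNgt => rt.
rewrite /duhamel integral0_eq// => z _; case/orP: rt => rt.
  rewrite /source patchE memNset ?mule0// => -/andP[/=].
  by rewrite ltNge rt.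
by rewrite /kern subr_gt0 ltNge rt mul0e.
Qed.

Let measurable_kern1 t x : measurable_fun setT (fun y : RN => kern t x y).
Proof. exact: measurable_fun_kern. Qed.

Let measurable_heat_measure t : (0 < t)%R ->
  measurable_fun setT (fun y => heat_measure t nu y).
Proof.
move=> t0; under eq_fun do rewrite heat_measureE//.
apply: (@measurable_fun_fubini_tonelli_F _ _ _ _ _ nu
  (fun q : RN * RN => kern t q.1 q.2)) => //.
  exact: measurable_fun_kern.
by move=> q; exact: kern_ge0.
Qed.

Let measurable_integral_duhamel t :
  measurable_fun setT (fun y => \int[leb]_r duhamel t y r).
Proof.
exact: (@measurable_fun_fubini_tonelli_F _ _ _ _ _ leb
  (fun q : RN * measurableTypeR R => duhamel t q.1 q.2)).
Qed.

(** Tonelli moves the kernel inside each term, where the semigroup law replaces the times [s] and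
    [s - r] by [t] and [t - r]. *)
Let kern_mild_rhs s t x : (0 < s)%R -> (s < t)%R -> (s < T)%R ->
  \int[lebN]_y (kern (t - s) x y * mild_rhs alpha nu u s y) = Psi t x s.
Proof.
move=> s0 st sT; have t0 : (0 < t)%R by exact: lt_trans st.
have ts0 : (0 < t - s)%R by rewrite subr_gt0.
under eq_integral => y _.
  rewrite mild_rhsE ?s0// /Psi duhamel_cut ge0_muleDr//; last first.
    by apply: integral_ge0.
  over.
rewrite ge0_integralD//; last 4 first.
- by move=> y _; rewrite mule_ge0// kern_ge0.
- by apply: emeasurable_funM => //; exact: measurable_heat_measure.
- by move=> y _; rewrite mule_ge0// ?kern_ge0//; exact: integral_ge0.
- exact: emeasurable_funM.
congr (_ + _).
  under eq_integral do rewrite heat_measureE//.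
  rewrite (integral_mul_swap lebN nu (f := fun p => kern s p.1 p.2))//; last 3 first.
  - exact: measurable_fun_kern.
  - by move=> y; exact: kern_ge0.
  - by move=> p; exact: kern_ge0.
  rewrite heat_measureE//; apply: eq_integral => z _.
  by rewrite kern_semigroup// s0 subrK.
rewrite (integral_mul_swap lebN leb (f := fun p => duhamel s p.1 p.2)); last 4 first.
- exact: measurable_kern1.
- exact: measurable_duhamel2.
- by move=> y; exact: kern_ge0.
- by move=> p; exact: duhamel_ge0.
rewrite [RHS]integral_mkcond; apply: eq_integral => r _; rewrite patchE.
rewrite (integral_mul_swap lebN lebN
  (f := fun p => kern (s - r) p.1 p.2 * source (r, p.2)))//; last 3 first.
- apply: emeasurable_funM; first exact: measurable_fun_kern.
  by apply: measurableT_comp => //; exact: measurable_fun_pair.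
- by move=> y; exact: kern_ge0.
- by move=> y; rewrite mule_ge0// kern_ge0.
(* The condition [r < s] left by [kern_semigroup] is the truncation of the time integral in
   [Psi t x s]. *)
have inner z : \int[lebN]_y (kern (t - s) x y * (kern (s - r) y z * source (r, z)))
    = (if (r < s)%R then kern (t - r) x z else 0) * source (r, z).
  under eq_integral do rewrite muleA.
  rewrite ge0_integralZr//; last 2 first.
  - by apply: emeasurable_funM => //; exact: measurable_fun_kern.
  - by move=> y _; rewrite mule_ge0// kern_ge0.
  by rewrite kern_semigroup// subr_gt0 addrA subrK.
under eq_integral do rewrite inner.
case: ifPn => [|]; rewrite ?inE ?notin_setE/= in_itv/=; first by move=> ->.
move=> /negP; rewrite -leNgt => sr; rewrite integral0_eq// => z _.
by rewrite ltNge sr mul0e.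
Qed.

Let u_ge0 s y : (0 < s < T)%R -> 0 <= u (s, y).
Proof. by move=> sT; case: hu => _ + _ _; exact. Qed.

Let measurable_slice s : (0 < s < T)%R -> measurable_fun setT (fun y => u (s, y)).
Proof.
move=> sT; case: hu => mu _ _ _ _ Y mY.
have := measurable_xsection s (mu mD Y mY); rewrite setTI.
congr measurable; apply/seteqP; split => y /=.
  by rewrite /xsection/= inE => -[].
by rewrite /xsection/= inE.
Qed.

(* At almost every time [s] the solution equals its right-hand side almost
   everywhere in space, so that applying the heat semigroup and then Jensen's
   inequality turns a lower bound on [Psi] into one on its derivative. *)
Let duhamel_ge t x c : (0 < t < T)%R -> (0 <= c)%R ->
  {ae leb, forall s, (0 < s < t)%R -> c%:E <= Psi t x s ->
    (c `^ alpha * c)%:E <= duhamel t x s}.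
Proof.
move=> /andP[t0 tT] c0; case: (hu) => _ _ _ /ae_xsection.
apply: filterS => s us /andP[s0 st] cPsi.
have sT : (0 < s < T)%R by rewrite s0 (lt_trans st).
have -> : duhamel t x s =
    \int[lebN]_z (kern (t - s) x z * (`|u (s, z)| `^ alpha * u (s, z))).
  by apply: eq_integral => z _; rewrite /source patchE mem_set.
apply: jensen_powR => //; first exact: measurable_slice.
- by move=> y; exact: kern_ge0.
- by move=> y; exact: u_ge0.
- by rewrite integral_kern// subr_gt0.
have mrhs : measurable_fun setT (mild_rhs alpha nu u s).
  rewrite (_ : mild_rhs _ _ _ _ =
      fun y => heat_measure s nu y + \int[leb]_r duhamel s y r); last first.
    by apply/funext => y; rewrite mild_rhsE// /Psi duhamel_cut.
  by apply: emeasurable_funD => //; exact: measurable_heat_measure.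
rewrite (le_trans cPsi)// -(kern_mild_rhs x s0 st)//; last by case/andP: sT.
rewrite le_eqVlt; apply/orP; left; apply/eqP/ge0_ae_eq_integral => //.
- exact: emeasurable_funM.
- by apply: emeasurable_funM => //; exact: measurable_slice.
- move=> y _; rewrite (mild_rhsE y sT).
  exact: (mule_ge0 (kern_ge0 _ _ _) (Psi_ge0 _ _ _)).
- by move=> y _; exact: (mule_ge0 (kern_ge0 _ _ _) (u_ge0 _ sT)).
by apply: filterS us => y us _; rewrite us.
Qed.

(** [Psi] is nondecreasing in its last argument, so it stays above [c] on the interval from [s] to
    [s + h]; there [duhamel] is almost everywhere at least [c^(1 + alpha)], and integrating gives
    the increment. *)
Let Psi_step t x s h c : (0 < t < T)%R -> (0 <= s)%R -> (0 < h)%R ->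
  (s + h <= t)%R -> (0 < c)%R -> c%:E <= Psi t x s ->
  (c + h * (c `^ alpha * c))%:E <= Psi t x (s + h)%R.
Proof.
move=> tT s0 h0 sht c0 cs.
have mdu (A : set (measurableTypeR R)) : measurable_fun A (duhamel t x).
  exact: (measurable_funTS (measurable_duhamel t x)).
have split_itv r : (s < r)%R ->
    Psi t x s + \int[leb]_(z in `]s, r[) duhamel t x z <= Psi t x r.
  move=> sr; rewrite /Psi -addeA leeD2l//.
  rewrite -ge0_integral_setU//=; last first.
    apply/disj_setPRL => z /=; rewrite !in_itv/= => /andP[sz _] zs.
    by move: (lt_trans sz zs); rewrite ltxx.
  apply: ge0_subset_integral => //=; first exact: measurableU.
  move=> z /= []; rewrite !in_itv/=; first by move=> /lt_trans; apply.
  by move=> /andP[].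
apply: le_trans (split_itv (s + h)%R _); last by rewrite ltrDl.
rewrite EFinD leeD//.
have -> : (h * (c `^ alpha * c))%:E =
    \int[leb]_(z in `]s, (s + h)%R[) (cst (c `^ alpha * c)%:E) z.
  rewrite integral_cst//= lebesgue_measure_itv/= lte_fin ltrDl h0.
  by rewrite -EFinD addrAC subrr add0r -EFinM mulrC.
apply: ae_ge0_le_integral => //=.
- by move=> z _; rewrite lee_fin mulr_ge0 ?powR_ge0// ltW.
have [A [mA A0 subA]] := duhamel_ge x tT (ltW c0).
exists A; split => //; apply: subset_trans subA => z /=; apply: contra_not => cz.
rewrite in_itv/= => /andP[sz zsh]; apply: cz.
  by rewrite (le_lt_trans s0)//= (lt_le_trans zsh).
rewrite (le_trans cs)// (le_trans _ (split_itv _ sz))// leeDl//.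
exact: integral_ge0.
Qed.

(** [blow_up_time] is applied to [Psi t x], which is finite at time [t] because it equals [u (t, x)]
    there. Using real numbers [c] below [heat_measure] includes the case where the latter is
    infinite. *)
Lemma solution_heat_bound : {ae (leb \x lebN)%E, forall p,
  (0 < (p.1 : R) < T)%R -> forall c, (0 < c)%R -> c%:E <= heat_measure p.1 nu p.2 ->
  (alpha * p.1 * c `^ alpha <= 1)%R}.
Proof.
case: (hu) => _ _; apply: filterS2 => -[t x] ufin urhs Dtx c c0 cA /=.
have tT : (0 < t < T)%R by [].
apply: (@blow_up_time _ (Psi t x)) => //.
- by case/andP: tT.
- by rewrite -mild_rhsE// -urhs// ltey_eq ufin.
- by rewrite (le_trans cA)// leeDl// integral_ge0.
- by move=> s h b *; exact: Psi_step.
Qed.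

End mild_solution.

(** * Balls, selection of points, and a lower bound for the heat flow *)

Section lebesgue_vec_positive.
Local Open Scope ereal_scope.
Context {R : realType} (N : nat).
Local Notation RN := (Rvec R N).
Local Notation lebN := (@lebesgue_vec R N).

Definition sq_ball (k : nat) : set RN := [set x | (sqnorm x <= k%:R)%R].

Lemma measurable_sq_ball k : measurable (sq_ball k).
Proof.
rewrite (_ : sq_ball k = @sqnorm R N @^-1` [set` `]-oo, (k%:R : R)]]); last first.
  by apply/seteqP; split => x /=; rewrite in_itv.
by rewrite -[X in measurable X]setTI; exact: measurable_sqnorm.
Qed.

Lemma bigcup_sq_ball : \bigcup_k sq_ball k = setT.
Proof.
apply/seteqP; split => // x _; exists (Num.bound (sqnorm x)) => //=.
by rewrite /sq_ball/= ltW// archi_boundP// sumr_ge0// => i _; exact: sqr_ge0.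
Qed.

Lemma nondecreasing_sq_ball : nondecreasing_seq sq_ball.
Proof.
move=> j k jk; apply/subsetPset => x; rewrite /sq_ball/= => /le_trans; apply.
by rewrite ler_nat.
Qed.

(** In each coordinate the difference of the two sides is the square of the sum. *)
Lemma sqnorm_vec_sub (x y : RN) :
  (sqnorm (vec_sub x y) <= 2 * (sqnorm x + sqnorm y))%R.
Proof.
rewrite /sqnorm -big_split mulr_sumr; apply: ler_sum => i _ /=.
rewrite tnth_mktuple.
by have := sqr_ge0 (tnth x i + tnth y i : R)%R; rewrite -subr_ge0; lra.
Qed.

(** If all balls were null, so would be their union, the whole space, and the heat kernel could not
    have integral 1. *)
Lemma lebesgue_vec_sq_ball_gt0 : exists k, 0 < lebN (sq_ball k).
Proof.
apply: contrapT => /forallNP noball.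
have ball0 k : lebN (sq_ball k) = 0.
  apply/eqP; rewrite eq_le measure_ge0 andbT leNgt; apply/negP; exact: noball.
have lebT : lebN setT = 0.
  apply/(negligibleP lebN measurableT); rewrite -bigcup_sq_ball.
  apply: negligible_bigcup => k.
  by apply/(negligibleP lebN (measurable_sq_ball k)); exact: ball0.
pose x0 : RN := [tuple (0%R : R) | i < N].
have := integral_heat_kernel x0 ltr01.
rewrite (@ge0_ae_eq_integral _ _ _ lebN setT _ (cst 0))//.
- by rewrite integral0 => /esym/eqP; rewrite onee_eq0.
- by apply/measurable_EFinP; exact: measurable_fun_heat_kernel.
- by move=> y _; rewrite lee_fin heat_kernel_ge0.
- exact: ae_eq0.
Qed.

(** The rectangle formed by the time interval and [E] has positive measure, so it is not contained
    in a null set. This turns almost everywhere bounds into bounds at an actual point. *)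
Lemma ae_exists (P : measurableTypeR R * RN -> Prop) (a b : R) (E : set RN) :
  {ae (lebesgue_measure \x lebN)%E, forall p, P p} -> (a < b)%R ->
  measurable E -> 0 < lebN E ->
  exists t x, [/\ (a < t < b)%R, E x & P (t, x)].
Proof.
move=> [A [mA A0 PA]] ab mE E0; apply: contrapT => none.
have sub : `]a, b[ `*` E `<=` A.
  move=> [t x] [/=]; rewrite in_itv/= => tab Ex; apply: PA => Ptx.
  by apply: none; exists t, x.
have : (lebesgue_measure \x lebN)%E (`]a, b[%classic `*` E) <= 0.
  by rewrite -A0 le_measure// inE//; exact: measurableX.
rewrite product_measure1E//= lebesgue_measure_itv/= lte_fin ab -EFinD.
by rewrite leNgt mule_gt0// lte_fin subr_gt0.
Qed.

Lemma heat_measure_ge (nu : {measure set RN -> \bar R}) (t r : R) (E : set RN)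
    (x : RN) : (0 < t)%R -> measurable E ->
  (forall y, E y -> (sqnorm (vec_sub x y) <= r)%R) ->
  ((4 * pi * t) `^ (- (N%:R / 2)) * expR (- (r / (4 * t))))%:E * nu E <=
  heat_measure t nu x.
Proof.
move=> t0 mE Er; have hk0 y : 0 <= (heat_kernel t (vec_sub x y))%:E.
  by rewrite lee_fin heat_kernel_ge0.
have mhk : measurable_fun setT (fun y => (heat_kernel t (vec_sub x y))%:E).
  by apply/measurable_EFinP; exact: measurable_fun_heat_kernel.
apply: (@le_trans _ _ (\int[nu]_(y in E) (heat_kernel t (vec_sub x y))%:E)).
  rewrite -integral_cst//; apply: ge0_le_integral => //=.
  - by move=> y _; rewrite lee_fin mulr_ge0 ?powR_ge0 ?expR_ge0.
  - exact: measurable_funTS.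
  - move=> y Ey; rewrite lee_fin ler_wpM2l ?powR_ge0// ler_expR lerN2.
    by rewrite ler_pM2r ?invr_gt0 ?mulr_gt0// Er.
exact: ge0_subset_integral.
Qed.

End lebesgue_vec_positive.

(** * Upper bound on the existence time *)

Section Tmax_bound.
Context {R : realType} (N : nat).
Local Notation RN := (Rvec R N).
Variables (alpha : R) (m : {finite_measure set RN -> \bar R}).
Hypothesis a0 : 0 < alpha.
Hypothesis beta0 : 0 < alpha^-1 - N%:R / 2.
Hypothesis m0 : m setT != 0%E.

Let beta := alpha^-1 - N%:R / 2.
Let M := fine (m setT).
Let K := alpha `^ alpha^-1 * (4 * pi) `^ (- (N%:R / 2)) * M.

Let M_gt0 : 0 < M.
Proof. by rewrite fine_gt0// lt0e m0 measure_ge0 -ge0_fin_numE ?fin_num_measure. Qed.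

Lemma mass_constant_gt0 : 0 < K.
Proof. by rewrite !mulr_gt0 ?powR_gt0// mulr_gt0// pi_gt0. Qed.

(** Raising the hypothesis to the power [alpha^-1] collects the powers of [t] into [t^beta]; then
    the root of order [beta] is taken. *)
Lemma time_le_of_heat_bound (t c : R) : 0 < t -> 0 < c ->
  alpha * t * ((4 * pi * t) `^ (- (N%:R / 2)) * c) `^ alpha <= 1 ->
  t <= (1 / (alpha `^ alpha^-1 * (4 * pi) `^ (- (N%:R / 2)) * c)) `^ beta^-1.
Proof.
move=> t0 c0; have p4 : 0 < 4 * pi :> R by rewrite mulr_gt0// pi_gt0.
set g := _ `^ (- _) * c => tg; have g0 : 0 < g by rewrite mulr_gt0 ?powR_gt0// mulr_gt0.
have tb : alpha `^ alpha^-1 * (4 * pi) `^ (- (N%:R / 2)) * c * t `^ beta <= 1.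
  have root : (alpha * t * g `^ alpha) `^ alpha^-1 <= 1.
    have ai0 : 0 <= alpha^-1 by rewrite invr_ge0 ltW.
    have tg0 : 0 <= alpha * t * g `^ alpha by rewrite !mulr_ge0 ?powR_ge0 ?ltW.
    by have := ge0_ler_powR ai0 tg0 ler01 tg; rewrite powR1.
  have gK : (g `^ alpha) `^ alpha^-1 = g.
    by rewrite -powRrM divff ?gt_eqF// powRr1// ltW.
  have at0 : 0 <= alpha * t by rewrite mulr_ge0 ?ltW.
  move: root; rewrite (powRM _ at0 (powR_ge0 _ _)) (powRM _ (ltW a0) (ltW t0)) gK.
  rewrite /g (powRM _ (ltW p4) (ltW t0)) /beta powRD; last first.
    by apply/implyP => _; rewrite gt_eqF.
  apply: le_trans; rewrite le_eqVlt; apply/orP; left; apply/eqP; ring.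
set L := _ * _ * c in tb *.
have L0 : 0 < L by rewrite !mulr_gt0// powR_gt0.
have tL : t `^ beta <= 1 / L by rewrite ler_pdivlMr// mulrC.
have := ge0_ler_powR (ltW (_ : 0 < beta^-1)) _ _ tL.
rewrite invr_gt0 !nnegrE powR_ge0 divr_ge0 ?(ltW L0)// => /(_ beta0 isT isT).
by rewrite -powRrM divff ?gt_eqF// powRr1 ?(ltW t0).
Qed.

(** Continuity of [m] from below along the balls, which exhaust the space. *)
Lemma mass_sq_ball (theta : R) : theta < 1 ->
  exists k, (theta * M < fine (m (@sq_ball R N k)))%R.
Proof.
move=> th1; apply: contrapT => /forallNP noball.
have mcvg : (m \o @sq_ball R N) n @[n --> \oo] --> m setT.
  rewrite -bigcup_sq_ball; apply: nondecreasing_cvg_mu.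
  - by move=> k; exact: measurable_sq_ball.
  - by rewrite bigcup_sq_ball.
  - exact: nondecreasing_sq_ball.
have : (m setT <= (theta * M)%:E)%E.
  rewrite -(cvg_lim _ mcvg)//; apply: lime_le; first exact: cvgP mcvg.
  apply: nearW => k /=; have mk := @measurable_sq_ball R N k.
  rewrite -[leLHS]fineK ?fin_num_measure//.
  by rewrite lee_fin leNgt; exact/negP.
rewrite -[leLHS]fineK ?fin_num_measure// lee_fin -/M leNgt => /negP; apply.
by rewrite gtr_pMl.
Qed.

(** The factor [theta] pays both for the mass outside a large ball and for the Gaussian factor at
    times beyond [t0]. Since [lambda] only scales the heat flow, [t0] does not depend on it. *)
Lemma Tmax_le (theta : R) : 0 < theta < 1 -> exists2 t0, 0 < t0 &
  forall lambda, 0 < lambda ->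
    (Tmax alpha (scale_measure lambda m) <=
      (Num.max t0 ((1 / (lambda * theta * K)) `^ beta^-1))%:E)%E.
Proof.
move=> /andP[th0 th1]; have [k0 k0E] := @lebesgue_vec_sq_ball_gt0 R N.
have [k mk] := mass_sq_ball th1.
set mu_k := fine _ in mk.
(* Bound on the squared distance between a point of [sq_ball k0] and one of [sq_ball k]. *)
pose r : R := 2 * (k0%:R + k%:R).
have r0 : 0 <= r by rewrite mulr_ge0// addr_ge0.
have d0 : 0 < mu_k - theta * M by rewrite subr_gt0.
have muk0 : 0 < mu_k by rewrite (lt_trans _ mk)// mulr_gt0.
(* Chosen so that [(1 - r / (4 * t)) * mu_k >= theta * M] for [t > t0]; the added 1 keeps [t0]
   positive even when [r] is 0. *)
pose t0 := r * mu_k / (4 * (mu_k - theta * M)) + 1.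
have t00 : 0 < t0.
  by rewrite ltr_pwDr// divr_ge0// mulr_ge0// ltW.
exists t0 => // lambda l0; apply: ge_ereal_sup => _ [->|[T [T0 [u hu]] <-]].
  by rewrite lee_fin le_max ltW.
rewrite lee_fin leNgt; apply/negP; rewrite gt_max => /andP[t0T].
set Th := _ `^ beta^-1 => ThT.
(* If [T] exceeded the maximum, the bound would hold at some [t] between that maximum and [T], with
   [x] in the ball [sq_ball k0]; it will force [t <= Th]. *)
have := @solution_heat_bound R N alpha T (mscale (`|lambda|%:nng)%R m) u a0 hu.
move=> /ae_exists/(_ _ (measurable_sq_ball k0) k0E).
have mT : Num.max t0 Th < T by rewrite gt_max t0T.
move=> /(_ _ _ mT)[t [x [/andP[tt Tt] xk0 /= H]]].
move: tt; rewrite gt_max => /andP[t0t Tht].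
have tgt0 : 0 < t by rewrite (lt_trans t00).
have g0 : 0 < (4 * pi * t) `^ (- (N%:R / 2)) by rewrite powR_gt0// !mulr_gt0// pi_gt0.
have c0 : 0 < lambda * theta * M by rewrite !mulr_gt0.
have tT : 0 < t < T by rewrite tgt0 Tt.
have {}H := H tT _ (mulr_gt0 g0 c0) _.
have : t <= Th.
  rewrite /Th /K (_ : lambda * theta * _ = alpha `^ alpha^-1 *
    (4 * pi) `^ (- (N%:R / 2)) * (lambda * theta * M)); last by ring.
  apply: time_le_of_heat_bound => //; apply: H.
  have hr y : @sq_ball R N k y -> sqnorm (vec_sub x y) <= r.
    move=> yk; apply: le_trans (sqnorm_vec_sub x y) _.
    by rewrite ler_pM2l// lerD.
  apply: le_trans (heat_measure_ge _ tgt0 (measurable_sq_ball k) hr).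
  rewrite [X in (_ * X)%E](_ : _ = (lambda * mu_k)%:E); last first.
    rewrite EFinM /mu_k fineK ?fin_num_measure//; last exact: measurable_sq_ball.
    by rewrite -[lambda in RHS]gtr0_norm.
  rewrite -EFinM lee_fin -[leRHS]mulrA ler_pM2l//.
  rewrite mulrCA -mulrA ler_pM2l//.
  have : 1 - r / (4 * t) <= expR (- (r / (4 * t))) by exact: expR_ge1Dx.
  move=> /(ler_wpM2r (ltW muk0)); apply: le_trans.
  have : r * mu_k / (4 * (mu_k - theta * M)) <= t.
    by apply: ltW; apply: lt_trans t0t; rewrite /t0 ltrDl.
  rewrite ler_pdivrMr ?mulr_gt0// => rt.
  have : r / (4 * t) * mu_k <= mu_k - theta * M.
    by rewrite mulrAC ler_pdivrMr ?mulr_gt0//; lra.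
  lra.
by rewrite leNgt Tht.
Qed.


End Tmax_bound.

(** * Letting [lambda] tend to zero *)

Section limsup.
Context {R : realType} (N : nat).
Local Notation RN := (Rvec R N).
Variables (alpha : R) (m : {finite_measure set RN -> \bar R}).
Hypothesis a0 : 0 < alpha.
Hypothesis beta0 : 0 < alpha^-1 - N%:R / 2.
Hypothesis m0 : m setT != 0%E.

Let beta := alpha^-1 - N%:R / 2.
Let K := alpha `^ alpha^-1 * (4 * pi) `^ (- (N%:R / 2)) * fine (m setT).

Lemma Tmax_lty lambda : 0 < lambda ->
  (Tmax alpha (scale_measure lambda m) < +oo)%E.
Proof.
move=> l0; have half : 0 < (2^-1 : R) < 1 by lra.
have [t0 _ H] := Tmax_le a0 beta0 m0 half.
exact: le_lt_trans (H _ l0) (ltry _).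
Qed.

(** After multiplication by [lambda^(1 / beta)], the term [t0] of [Tmax_le] tends to 0, while the
    other term becomes [L * theta^(-1 / beta)], which is close to [L] for [theta] close to 1. *)
Lemma limsup_Tmax_le :
  (limf_esup (fun lambda : R => (lambda `^ beta^-1)%:E *
      Tmax alpha (scale_measure lambda m)) (0 : R)^'+ <=
   ((1 / K) `^ beta^-1)%:E)%E.
Proof.
have K0 : 0 < K by exact: mass_constant_gt0.
have bi0 : 0 < beta^-1 by rewrite invr_gt0.
set L := (1 / K) `^ beta^-1.
have L0 : 0 < L by rewrite powR_gt0// divr_gt0.
apply/lee_addgt0Pr => e e0.
(* [rho] is chosen so that [L * rho = L + e], and [theta] below so that
   [theta^(-1 / beta) = rho]. *)
pose rho := 1 + e / L.
have rho1 : 1 < rho by rewrite ltrDl divr_gt0.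
have rho0 : 0 < rho by rewrite (lt_trans _ rho1).
pose theta := rho `^ (- beta).
have th0 : 0 < theta by rewrite powR_gt0.
have th1 : theta < 1.
  rewrite /theta powRN invf_lt1 ?powR_gt0//.
  by have := gt0_ltr_powR beta0 ler01 (ltW rho0) rho1; rewrite powR1.
have [|t0 t00 H] := @Tmax_le R N alpha m a0 beta0 m0 theta; first by rewrite th0.
have Lrho : L%:E + e%:E = (L * rho)%:E :> \bar R.
  by rewrite -EFinD /rho mulrDr mulr1 mulrCA divff ?gt_eqF// mulr1.
rewrite Lrho limf_esupE.
(* Below [delta], the rescaled term [lambda^(1 / beta) * t0] is at most [L]. *)
pose delta := (L / t0) `^ beta.
have delta0 : 0 < delta by rewrite powR_gt0// divr_gt0.
pose V : set R := [set l | 0 < l < delta].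
have FV : (0 : R)^'+ V.
  near=> l; rewrite /V/=; apply/andP; split; near: l.
    exact: nbhs_right_gt.
  exact: nbhs_right_lt.
apply: (@le_trans _ _ (ereal_sup ((fun lambda : R => (lambda `^ beta^-1)%:E *
      Tmax alpha (scale_measure lambda m)) @` V)%E)).
  by apply: ereal_inf_lbound; exists V.
apply: ge_ereal_sup => _ [l /andP[l0 ldelta] <-].
have lb0 : 0 < l `^ beta^-1 by rewrite powR_gt0.
apply: le_trans (lee_wpmul2l _ (H _ l0)) _; first by rewrite lee_fin ltW.
rewrite -EFinM lee_fin maxr_pMr ?(ltW lb0)// ge_max; apply/andP; split.
  have : l `^ beta^-1 <= L / t0.
    have := ge0_ler_powR (ltW bi0) (ltW l0) (ltW delta0) (ltW ldelta).
    by rewrite /delta -powRrM divff ?gt_eqF// powRr1// divr_ge0// ltW.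
  rewrite ler_pdivlMr// => /le_trans; apply.
  by rewrite ler_peMr// ltW.
have ltK0 : 0 <= 1 / (l * theta * K).
  exact: divr_ge0 ler01 (ltW (mulr_gt0 (mulr_gt0 l0 th0) K0)).
rewrite -(powRM _ (ltW l0) ltK0).
have -> : l * (1 / (l * theta * K)) = 1 / K * theta^-1.
  by field; rewrite !gt_eqF.
have K1 : 0 <= 1 / K by rewrite divr_ge0// ltW.
rewrite powRM ?invr_ge0 ?(ltW th0)// -/L ler_pM2l//.
by rewrite /theta powRN invrK -powRrM divff ?gt_eqF// powRr1// ltW.
Unshelve. all: by end_near. Qed.

End limsup.

Theorem theorem1p8 (R : realType) (N : nat) (hN : (1 <= N)%N)
  (alpha : R) (halpha0 : 0 < alpha) (halpha : alpha < 2 / N%:R)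
  (m : {finite_measure set (Rvec R N) -> \bar R})
  (hm : m [set: Rvec R N] != 0%E) :
  (forall lambda : R, 0 < lambda ->
     (Tmax alpha (scale_measure lambda m) < +oo)%E) /\
  (limf_esup
     (fun lambda : R =>
        (lambda `^ (alpha^-1 - N%:R / 2)^-1)%:E *
        Tmax alpha (scale_measure lambda m))
     (0 : R)^'+
   <= (1 / (alpha `^ alpha^-1 * (4 * pi) `^ (- (N%:R / 2)) *
            fine (m [set: Rvec R N]))
         `^ (alpha^-1 - N%:R / 2)^-1)%:E)%E.
Proof.
have N0 : 0 < N%:R :> R by rewrite ltr0n.
(* This is the subcriticality condition [alpha < 2 / N] after inversion. *)
have beta0 : 0 < alpha^-1 - N%:R / 2.
  by rewrite subr_gt0 -(invf_div 2) ltf_pV2 ?posrE// divr_gt0.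
split; first exact: Tmax_lty.
have K0 := mass_constant_gt0 halpha0 hm.
have := limsup_Tmax_le halpha0 beta0 hm.
(* The power is exchanged with the reciprocal: [(1 / K)^(1 / beta) = 1 / K^(1 / beta)]. *)
by rewrite !div1r -(powR_inv1 (ltW K0)) -powRrM mulN1r powRN.
Qed.
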